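(* Let $\mathcal{G}=(\Gamma,\{G_v\}_{v\in V},\{G_e\}_{e\in E},\{\partial_e\}_{e\in E})$ be a finite graph of groups in which each vertex group $G_v$ admits a finite complete rewriting system left compatible with the collection of subgroups $\{\partial_e(G_e)\}_{e\in E,\,o(e)=v}$. Then the group $F(\mathcal{G},\Gamma)$ admits a finite complete rewriting system.
   Context: Rewriting systems. A rewriting system is a pair $(X,\mathcal{R})$ with $X$ a finite set and $\mathcal{R}\subseteq X^*\times X^*$, where $X^*$ is the free monoid on $X$. Write $x\to_{\mathcal{R}}y$ if $x=x_1ux_2$, $y=x_1vx_2$ for some $(u,v)\in\mathcal{R}$, and let $\to^*_{\mathcal{R}}$ be the reflexive transitive closure. A word $x$ is irreducible if there is no $y\neq x$ with $x\to_{\mathcal{R}}y$. The system is finite if $X$ and $\mathcal{R}$ are finite; terminating if there is no infinite chain $x_0\to_{\mathcal{R}}x_1\to_{\mathcal{R}}\cdots$; confluent if whenever $x\to^*_{\mathcal{R}}y$ and $x\to^*_{\mathcal{R}}z$ there is $\bar x$ with $y\to^*_{\mathcal{R}}\bar x$ and $z\to^*_{\mathcal{R}}\bar x$; complete if terminating and confluent. A group $G$ admits the finite complete rewriting system $(X,\mathcal{R})$ if that system is finite and complete and the monoid with presentation $\langle X\mid\mathcal{R}\rangle$ is isomorphic to $G$; then $\pi\colon X^*\to G$ denotes the corresponding monoid epimorphism. Left compatibility. Let $(X,\mathcal{R})$ be a finite complete rewriting system for $G$ and $\{G_\alpha\}_{\alpha\in A}$ a collection of finitely generated subgroups of $G$.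 Then $(X,\mathcal{R})$ is left compatible with $\{G_\alpha\}_{\alpha\in A}$ if for each $\alpha$ there are a finite set $X_\alpha$, a monoid epimorphism $\pi_\alpha\colon X_\alpha^*\to G_\alpha\leqslant G$, and a finite set $\mathcal{R}_\alpha$ of rewriting rules over the alphabet $X\cup X_\alpha\cup\{t_\alpha\}$, where $t_\alpha$ is a new letter, such that: (1) the rewriting system $(X\cup X_\alpha\cup\{t_\alpha\},\mathcal{R}\cup\mathcal{R}_\alpha)$ is terminating; (2) each rule in $\mathcal{R}_\alpha$ is of the form $(t_\alpha u,vt_\alpha w)$ with $u,w\in X^*$, $v\in X_\alpha^*$ and $\pi(u)=\pi_\alpha(v)\pi(w)$; (3) if $t_\alpha u$ and $t_\alpha v$ are irreducible for $(X\cup X_\alpha\cup\{t_\alpha\},\mathcal{R}\cup\mathcal{R}_\alpha)$ with $u,v\in X^*$, then $u=v$ if and only if $G_\alpha\cdot\pi(u)=G_\alpha\cdot\pi(v)$. Graphs of groups. $\Gamma$ is a connected graph with vertex set $V$, edge set $E$, origin map $o\colon E\to V$ and fixed-point-free involution $e\mapsto\overline e$ on $E$ (edge reversal). The graph of groups $\mathcal{G}$ assigns a group $G_v$ to each $v\in V$, a group $G_e=G_{\overline e}$ to each $e\in E$, and a monomorphism $\partial_e\colon G_e\to G_{o(e)}$ to each $e\in E$. It is finite if $\Gamma$ is finite. If $\langle S_v\mid R_v\rangle$ is a presentation of $G_v$ for each $v\in V$, then \[ F(\mathcal{G},\Gamma)=\big\langle\{S_v\}_{v\in V}\cup\{t_e\}_{e\in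 E}\ \big|\ \{R_v\}_{v\in V}\cup\{t_e^{-1}=t_{\overline e}\}_{e\in E}\cup\{t_e^{-1}\partial_e(g)t_e=\partial_{\overline e}(g)\}_{e\in E,\,g\in G_e}\big\rangle . \] *)

(* Defs.v *)
From HB Require Import structures.
From Stdlib Require Import Relation_Operators.
From mathcomp Require Import all_boot monoid.
From mathcomp Require Import boolp classical_sets functions cardinality.

Set Implicit Arguments.
Unset Strict Implicit.
Unset Printing Implicit Defensive.

Local Open Scope classical_set_scope.
Local Open Scope group_scope.

(** * Rewriting systems *)

Definition rules (X : Type) := set (seq X * seq X).

Definition rewrite1 (X : Type) (R : rules X) (x y : seq X) : Prop :=
  exists x1 x2 u v, [/\ R (u, v), x = x1 ++ u ++ x2 & y = x1 ++ v ++ x2].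

Definition rewrites (X : Type) (R : rules X) : seq X -> seq X -> Prop :=
  clos_refl_trans (seq X) (rewrite1 R).

Definition irreducible (X : Type) (R : rules X) (x : seq X) : Prop :=
  ~ exists y, y <> x /\ rewrite1 R x y.

Definition terminating (X : Type) (R : rules X) : Prop :=
  ~ exists x : nat -> seq X, forall n, rewrite1 R (x n) (x n.+1).

Definition confluent (X : Type) (R : rules X) : Prop :=
  forall x y z, rewrites R x y -> rewrites R x z ->
  exists x', rewrites R y x' /\ rewrites R z x'.

Definition complete (X : Type) (R : rules X) : Prop :=
  terminating R /\ confluent R.

(** * Presentations *)

Definition word_morphism (X : Type) (M : monoidType) (pi : seq X -> M) : Prop :=
  pi [::] = 1 /\ forall u v, pi (u ++ v) = pi u * pi v.

Definition congruence (X : Type) (R : rules X) : seq X -> seq X -> Prop :=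
  clos_refl_sym_trans (seq X) (rewrite1 R).

(* [pi] induces an isomorphism from the monoid <X | R> onto M. *)
Definition monoid_presentation (X : Type) (R : rules X) (M : monoidType)
    (pi : seq X -> M) : Prop :=
  [/\ word_morphism pi, range pi = setT
    & forall u v, pi u = pi v <-> congruence R u v].

(* Group words on S are words on S * bool: (s, false) stands for s and
   (s, true) for s^-1. *)
Definition cancellation (S : Type) : rules (S * bool) :=
  [set r | exists s b, r = ([:: (s, b); (s, ~~ b)], [::])].

(* A pair (u, v) in R stands for the relation u = v;
   [pi] induces an isomorphism from the group <S | R> onto G. *)
Definition group_presentation (S : Type) (R : rules (S * bool)) (G : groupType)
    (pi : seq (S * bool) -> G) : Prop :=
  monoid_presentation (R `|` @cancellation S) pi.

Definition is_fcrs (G : groupType) (X : finType) (R : rules X)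
    (pi : seq X -> G) : Prop :=
  [/\ finite_set R, complete R & monoid_presentation R pi].

Definition admits_fcrs (G : groupType) : Prop :=
  exists (X : finType) (R : rules X) (pi : seq X -> G), is_fcrs R pi.

(** * Left compatibility *)

Section LeftCompatibility.
Variables (G : groupType) (X : finType) (R : rules X) (pi : seq X -> G).

Section Alphabet.
Variable Y : finType.

(* The alphabet X \cup Y \cup {t}. Taking X and Y disjoint is no restriction:
   rules of the form (t u, v t w) can be pulled back from an overlapping union,
   where the letters of v are renamed apart. *)
Definition ext_alphabet : Type := (X + Y + unit)%type.
Definition ext_l (u : seq X) : seq ext_alphabet := [seq inl (inl x) | x <- u].
Definition ext_r (v : seq Y) : seq ext_alphabet := [seq inl (inr y) | y <- v].
Definition ext_t : ext_alphabet := inr tt.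

Definition ext_rules (RY : rules ext_alphabet) : rules ext_alphabet :=
  [set (ext_l r.1, ext_l r.2) | r in R] `|` RY.

End Alphabet.

Definition right_coset (H : set G) (g : G) : set G := [set h * g | h in H].

Definition left_compatible_with (H : set G) : Prop :=
  exists (Y : finType) (piY : seq Y -> G) (RY : rules (ext_alphabet Y)),
    [/\ word_morphism piY /\ range piY = H,
        finite_set RY,
        terminating (ext_rules RY),
        forall r, RY r -> exists u v w,
          r = (ext_t Y :: ext_l Y u, ext_r v ++ ext_t Y :: ext_l Y w)
          /\ pi u = piY v * pi w
      & forall u v,
          irreducible (ext_rules RY) (ext_t Y :: ext_l Y u) ->
          irreducible (ext_rules RY) (ext_t Y :: ext_l Y v) ->
          u = v <-> right_coset H (pi u) = right_coset H (pi v)].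

(* Each H a is finitely generated, as the image of a free monoid of finite
   rank. *)
Definition left_compatible (A : Type) (H : A -> set G) : Prop :=
  forall a, left_compatible_with (H a).

End LeftCompatibility.

(** * Graphs of groups *)

Record finite_graph := FiniteGraph {
  vertex : finType;
  edge : finType;
  orig : edge -> vertex;
  rev_edge : edge -> edge;
  rev_edgeK : involutive rev_edge;
  rev_edge_neq : forall e, rev_edge e != e }.

Definition adjacent (Gamma : finite_graph) : rel (vertex Gamma) :=
  fun v w => [exists e, (orig e == v) && (orig (rev_edge e) == w)].

Definition connected_graph (Gamma : finite_graph) : Prop :=
  forall v w, connect (@adjacent Gamma) v w.

Record graph_of_groups (Gamma : finite_graph) := GraphOfGroups {
  vertex_group : vertex Gamma -> groupType;
  edge_group : edge Gamma -> groupType;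
  edge_group_rev : forall e, edge_group e = edge_group (rev_edge e);
  boundary : forall e,
    {multiplicative edge_group e -> vertex_group (orig e)};
  boundary_inj : forall e, injective (boundary e) }.

Section GraphOfGroups.
Variables (Gamma : finite_graph) (GG : graph_of_groups Gamma).

(* The identification of G_e with G_(rev_edge e). Equality proofs are
   irrelevant (Prop_irrelevance), so the casts for e and rev_edge e are
   mutually inverse up to rev_edgeK. *)
Definition rev_elt (e : edge Gamma) (g : edge_group GG e) :
    edge_group GG (rev_edge e) :=
  ecast H (Group.sort H) (edge_group_rev GG e) g.

Definition incident_edge (v : vertex Gamma) := {e : edge Gamma | orig e = v}.

Definition incident_subgroup (v : vertex Gamma) (a : incident_edge v) :
    set (vertex_group GG v) :=
  ecast w (set (vertex_group GG w)) (svalP a) (range (boundary GG (sval a))).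

Section Fundamental.
Variable S : vertex Gamma -> Type.
Variable R : forall v, rules (S v * bool).
Variable pi : forall v, seq (S v * bool) -> vertex_group GG v.

Definition F_gen : Type := ({v & S v} + edge Gamma)%type.

Definition F_lift (v : vertex Gamma) (w : seq (S v * bool)) :
    seq (F_gen * bool) :=
  [seq (inl (existT S v x.1), x.2) | x <- w].

(* In [F_conj] the elements boundary e g and boundary (rev_edge e) g are
   written as words in the generators of the respective vertex groups; all
   words representing them are allowed, which is harmless modulo [F_vertex]. *)
Inductive F_rel : seq (F_gen * bool) * seq (F_gen * bool) -> Prop :=
| F_vertex v r of R r : F_rel (F_lift (v := v) r.1, F_lift r.2)
| F_inv e : F_rel ([:: (inr e, true)], [:: (inr (rev_edge e), false)])
| F_conj e (g : edge_group GG e) w w' of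
    pi w = boundary GG e g &
    pi w' = boundary GG (rev_edge e) (rev_elt g) :
    F_rel ((inr e, true) :: F_lift w ++ [:: (inr e, false)], F_lift w').

End Fundamental.
End GraphOfGroups.

(* Main.v *)
(** In F the letter s_e = t_e^-1 satisfies s_e d_e(g) = d_(rev e)(g) s_e, so each
    rule (t u, v t w) for d_e(G_e) gives a rule s_e u -> v' s_e w, where v' is a
    word over the alphabet of the other end vertex. These rules, the vertex rules
    and s_(rev e) s_e -> 1 form the system.

    Termination: the number of edge letters never increases, and while it is
    constant the word right of the last edge letter can change only finitely
    often, whatever is emitted to its left.

    Confluence: the group F acts on a set of normal words (van der Waerden's
    trick), and every word u rewrites to the normal word that u, read in F, makes
    out of the empty one. So this normal word is an invariant of the class of u,
    which also shows that F is the monoid presented by the system. *)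

From Stdlib Require Import Relation_Operators.
Require Import Defs.
From mathcomp Require Import all_boot monoid.
From mathcomp Require Import boolp classical_sets functions cardinality.

Set Implicit Arguments.
Unset Strict Implicit.
Unset Printing Implicit Defensive.

Local Open Scope classical_set_scope.
Local Open Scope group_scope.

(** Levi's lemma for free monoids; it locates a redex relative to a given cut of a word. *)
Lemma eq_cat (T : Type) (a b c d : seq T) : a ++ b = c ++ d ->
  (exists m, a = c ++ m /\ d = m ++ b) \/ (exists m, c = a ++ m /\ b = m ++ d).
Proof.
elim: a c => [|x a IH] [|y c] /=.
- by move=> ->; left; exists [::].
- by move=> ->; right; exists (y :: c).
- by move=> <-; left; exists (x :: a).
- case=> <- /IH [[m [-> ->]]|[m [-> ->]]]; [left|right]; by exists m.
Qed.

Lemma map_eq_cat (T U : Type) (f : T -> U) p a b : map f p = a ++ b ->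
  exists p1 p2, [/\ p = p1 ++ p2, a = map f p1 & b = map f p2].
Proof.
move=> h; exists (take (size a) p), (drop (size a) p).
by rewrite cat_take_drop map_take map_drop h take_size_cat ?drop_size_cat.
Qed.

(** * Rewriting systems *)

Section Rewriting.
Variables (X : Type) (R : rules X).

Lemma rewrite1_rule l r : R (l, r) -> rewrite1 R l r.
Proof. by move=> h; exists [::], [::], l, r; rewrite /= !cats0. Qed.

Lemma rewrite1_catl z x y : rewrite1 R x y -> rewrite1 R (z ++ x) (z ++ y).
Proof.
by case=> x1 [x2 [u [v [h -> ->]]]]; exists (z ++ x1), x2, u, v; rewrite !catA.
Qed.

Lemma rewrite1_catr z x y : rewrite1 R x y -> rewrite1 R (x ++ z) (y ++ z).
Proof.
by case=> x1 [x2 [u [v [h -> ->]]]]; exists x1, (x2 ++ z), u, v; rewrite -!catA.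
Qed.

Lemma rewrites_trans x y z : rewrites R x y -> rewrites R y z -> rewrites R x z.
Proof. exact: rt_trans. Qed.

Lemma rewrites_map Y (R' : rules Y) (f : seq X -> seq Y) :
  (forall x y, rewrite1 R x y -> rewrite1 R' (f x) (f y)) ->
  forall x y, rewrites R x y -> rewrites R' (f x) (f y).
Proof.
move=> h x y; elim=> [a b /h|a|a b c _ h1 _ h2]; first exact: rt_step.
- exact: rt_refl.
- exact: rt_trans h1 h2.
Qed.

Lemma rewrites_congruence x y : rewrites R x y -> congruence R x y.
Proof.
elim=> [a b|a|a b c _ h1 _ h2]; [exact: rst_step|exact: rst_refl|].
exact: rst_trans h1 h2.
Qed.

Lemma congruence_rule l r : R (l, r) -> congruence R l r.
Proof. by move=> h; apply/rst_step/rewrite1_rule. Qed.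

Lemma congruence_ind (P : seq X -> seq X -> Prop) :
  (forall x, P x x) -> (forall x y, P x y -> P y x) ->
  (forall x y z, P x y -> P y z -> P x z) ->
  (forall x y, rewrite1 R x y -> P x y) ->
  forall x y, congruence R x y -> P x y.
Proof. by move=> h1 h2 h3 h4 x y; elim=> *; eauto. Qed.

(** A word that is not accessible has a successor of the same kind, and choosing such successors
    yields an infinite chain. *)
Lemma terminating_wf : terminating R <-> well_founded (fun y x => rewrite1 R x y).
Proof.
split=> [tR x|wf [x hx]].
  apply: contrapT => nx; apply: tR.
  pose T := {x | ~ Acc (fun y x => rewrite1 R x y) x}.
  have step (t : T) : exists t' : T, rewrite1 R (sval t) (sval t').
    case: t => y ny /=; apply: contrapT => h; apply: ny; constructor => z hz.
    by apply: contrapT => nz; apply: h; exists (exist _ z nz).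
  have [f hf] := choice step.
  exists (fun n => sval (iter n f (exist _ x nx))) => n /=.
  exact: hf.
have : forall y n, y <> x n.
  move=> y; elim: (wf y) => {}y _ IH n yn.
  by apply: (IH (x n.+1)) (erefl); rewrite yn.
by move=> /(_ (x 0) 0).
Qed.

(** A rule with empty left side applies to every word, so the powers of [v] would form an infinite
    chain. *)
Lemma terminating_nil v : terminating R -> ~ R ([::], v).
Proof.
move=> tR hR; apply: tR; exists (fun n => flatten (nseq n v)) => n.
by exists [::], (flatten (nseq n v)), [::], v.
Qed.

Lemma terminating_irreducible x : terminating R ->
  exists2 y, rewrites R x y & irreducible R y.
Proof.
move=> /terminating_wf wf; elim: (wf x) => {}x _ IH.
have [[y [yx xy]]|nx] := pselect (exists y, y <> x /\ rewrite1 R x y).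
  have [z yz iz] := IH _ xy; exists z => //.
  exact: rewrites_trans (rt_step _ _ _ _ xy) yz.
by exists x => //; apply: rt_refl.
Qed.

Lemma irreducible_rewrites x y : irreducible R x -> rewrites R x y -> y = x.
Proof.
move=> + h; elim: h => {x y} [x y xy ix|//|x y z _ IHx _ IHy ix].
  by apply: contrapT => yx; apply: ix; exists y.
have yx := IHx ix; rewrite yx in IHy; exact: IHy.
Qed.

Lemma irreducible_nil : terminating R -> irreducible R [::].
Proof.
move=> tR [y [ny [x1 [x2 [u [v [h e _]]]]]]].
by case: x1 u x2 e h => [|//] [|//] _ _ /(terminating_nil tR).
Qed.

Lemma church_rosser x y : confluent R -> congruence R x y ->
  exists2 z, rewrites R x z & rewrites R y z.
Proof.
move=> cR; move: x y; refine (@congruence_ind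
  (fun x y => exists2 z, rewrites R x z & rewrites R y z) _ _ _ _).
- by move=> x; exists x; apply: rt_refl.
- by move=> x y [z]; exists z.
- move=> x y z [a xa ya] [b yb zb]; have [c [ac bc]] := cR _ _ _ ya yb.
  by exists c; [exact: rewrites_trans xa ac|exact: rewrites_trans zb bc].
- by move=> x y xy; exists y; [exact: rt_step|exact: rt_refl].
Qed.

Lemma irreducible_congruence x y : confluent R -> irreducible R x ->
  irreducible R y -> congruence R x y -> x = y.
Proof.
move=> cR ix iy /(church_rosser cR) [z xz yz].
by rewrite -(irreducible_rewrites ix xz) (irreducible_rewrites iy yz).
Qed.

End Rewriting.

Lemma word_morphism_flatten (A B : Type) (M : monoidType) (p : seq A -> M)
    (q : seq B -> M) (f : A -> seq B) : word_morphism p -> word_morphism q ->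
  (forall a, q (f a) = p [:: a]) -> forall w, q (flatten (map f w)) = p w.
Proof.
move=> [p1 pM] [q1 qM] h; elim=> [|a w IH] /=; first by rewrite p1.
by rewrite qM h IH -pM.
Qed.

(** * Normal forms in a group with a finite complete rewriting system *)

Section Fcrs.
Variables (G : groupType) (X : finType) (R : rules X) (rho : seq X -> G).
Hypothesis hR : is_fcrs R rho.

Lemma fcrs_term : terminating R. Proof. by case: hR => _ []. Qed.
Lemma fcrs_confl : confluent R. Proof. by case: hR => _ []. Qed.
Lemma fcrs1 : rho [::] = 1. Proof. by case: hR => _ _ [[]]. Qed.
Lemma fcrsM u v : rho (u ++ v) = rho u * rho v.
Proof. by case: hR => _ _ [[_ ->]]. Qed.
Lemma fcrs_congr u v : rho u = rho v <-> congruence R u v.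
Proof. by case: hR => _ _ []. Qed.
Lemma fcrs_surj g : exists w, rho w = g.
Proof.
case: hR => _ _ [_ h _]; have : [set: G] g by [].
by rewrite -h => -[w _ <-]; exists w.
Qed.

Lemma fcrs_nf_ex g : exists w, rho w = g /\ irreducible R w.
Proof.
have [w <-] := fcrs_surj g; have [z wz iz] := terminating_irreducible w fcrs_term.
by exists z; split=> //; apply/esym/fcrs_congr/rewrites_congruence.
Qed.

Definition fcrs_nf g : seq X := sval (cid (fcrs_nf_ex g)).

Lemma fcrs_nfK g : rho (fcrs_nf g) = g.
Proof. by rewrite /fcrs_nf; case: cid => w []. Qed.

Lemma fcrs_nf_irr g : irreducible R (fcrs_nf g).
Proof. by rewrite /fcrs_nf; case: cid => w []. Qed.

Lemma irr_fcrs_nf w : irreducible R w -> fcrs_nf (rho w) = w.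
Proof.
move=> iw; apply: (irreducible_congruence fcrs_confl _ iw).
  exact: fcrs_nf_irr.
by apply/fcrs_congr; rewrite fcrs_nfK.
Qed.

Lemma rewrites_fcrs_nf w : rewrites R w (fcrs_nf (rho w)).
Proof.
have [z wz iz] := terminating_irreducible w fcrs_term.
by rewrite ((fcrs_congr _ _).2 (rewrites_congruence wz)) irr_fcrs_nf.
Qed.

End Fcrs.
(** * Free products of terminating systems *)

Section FreeProduct.
Variables (I : finType) (X : I -> finType) (E : Type) (Q : forall i, rules (X i)).

Definition letter : Type := ({i & X i} + E)%type.
Definition block i (p : seq (X i)) : seq letter := [seq inl (existT X i x) | x <- p].
Definition starts_off i (m : seq letter) : Prop :=
  forall x m', m <> inl (existT X i x) :: m'.
Definition free_rules : rules letter :=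
  \bigcup_i [set (block r.1, block r.2) | r in @Q i].

Lemma block_cat i (p q : seq (X i)) : block (p ++ q) = block p ++ block q.
Proof. exact: map_cat. Qed.

Lemma letter_inj i : injective (fun x : X i => inl (existT X i x) : letter).
Proof.
by move=> x y [] /eqP; rewrite eq_Tagged => /eqP.
Qed.

Lemma block_inj i : injective (@block i).
Proof. exact/inj_map/letter_inj. Qed.

Lemma block_eq_cat i (p : seq (X i)) a b : block p = a ++ b ->
  exists p1 p2, [/\ p = p1 ++ p2, a = block p1 & b = block p2].
Proof.
exact: map_eq_cat.
Qed.

Lemma block_starts_off i (p : seq (X i)) m : starts_off i (block p ++ m) -> p = [::].
Proof. by case: p => // x p /(_ x (block p ++ m)). Qed.

Lemma split_ex i w : exists pm : seq (X i) * seq letter,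
  w = block pm.1 ++ pm.2 /\ starts_off i pm.2.
Proof.
elim: w => [|l w [[p m] /= [-> fm]]]; first by exists ([::], [::]).
have [[x ->]|nl] := pselect (exists x, l = inl (existT X i x)).
  by exists (x :: p, m).
exists ([::], l :: (block p ++ m)); split=> // x m' [lx _]; apply: nl; by exists x.
Qed.

Lemma split_uniq i (p p' : seq (X i)) m m' :
  block p ++ m = block p' ++ m' -> starts_off i m -> starts_off i m' -> p = p' /\ m = m'.
Proof.
move=> /eq_cat [] [k [h ->]] f f'.
  have [p1 [p2 [-> /block_inj <- kE]]] := block_eq_cat h.
  by move: f'; rewrite kE => /block_starts_off ->; rewrite cats0.
have [p1 [p2 [-> /block_inj <- kE]]] := block_eq_cat h.
by move: f; rewrite kE => /block_starts_off ->; rewrite cats0.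
Qed.

Lemma free_rulesP r : free_rules r <->
  exists i u v, @Q i (u, v) /\ r = (block u, block v).
Proof.
split=> [[i _ [[u v] h <-]]|[i [u [v [h ->]]]]]; first by exists i, u, v.
by exists i => //; exists (u, v).
Qed.

Lemma rewrite1_free i p q : rewrite1 (@Q i) p q -> rewrite1 free_rules (block p) (block q).
Proof.
case=> x1 [x2 [u [v [h -> ->]]]]; exists (block x1), (block x2), (block u), (block v).
by rewrite !block_cat; split=> //; apply/free_rulesP; exists i, u, v.
Qed.

Definition color (l : letter) : option I := if l is inl t then Some (tag t) else None.
Definition head_color (w : seq letter) : option I := if w is l :: _ then color l else None.
(* Letters of E have no color; they are inert for [free_rules]. *)
Fixpoint changes (w : seq letter) : nat :=
  if w is l :: w' then (color l != head_color w') + changes w' else 0.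

Lemma changes_block i x (p : seq (X i)) m :
  changes (block (x :: p) ++ m) = (Some i != head_color m) + changes m.
Proof. by elim: p x => //= y p IH x; rewrite eqxx /= -IH. Qed.

Lemma changes_starts_off i x (p : seq (X i)) m : starts_off i m ->
  changes m < changes (block (x :: p) ++ m).
Proof.
rewrite changes_block => fm; rewrite -addn1 addnC leq_add2r lt0b.
case: m fm => [//|[[j y]|e] m] fm //=.
by apply/eqP => -[ij]; subst j; exact: (fm y m).
Qed.

Hypothesis termQ : forall i, terminating (@Q i).

Lemma changes_rewrite1 w w' : rewrite1 free_rules w w' -> changes w' <= changes w.
Proof.
case=> x1 [x2 [u [v [/free_rulesP [i [u0 [v0 [h [-> ->]]]]] -> ->]]]].
(* The claim is strengthened for the induction on [x1]: if the head color differs, prepending a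
   letter may create one change, and a strict drop pays for it. *)
suff : (head_color (x1 ++ block v0 ++ x2) = head_color (x1 ++ block u0 ++ x2) /\
        changes (x1 ++ block v0 ++ x2) <= changes (x1 ++ block u0 ++ x2)) \/
       changes (x1 ++ block v0 ++ x2) < changes (x1 ++ block u0 ++ x2).
  by case=> [[]//|/ltnW].
elim: x1 => [|l x1 IH] /=.
  case: u0 h => [/(terminating_nil (@termQ i))//|x u0 _].
  rewrite changes_block; case: v0 => [/=|y v0]; last first.
    by rewrite changes_block; left.
  case: eqP => hx /=; last by right; rewrite add1n.
  by left; rewrite hx add0n.
case: IH => [[-> h1]|h1]; left; split=> //; first by rewrite leq_add2l.
by apply: leq_trans (leq_addl _ _); apply: leq_trans h1; rewrite -add1n leq_add2r leq_b1.
Qed.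

(** A left side that begins inside [block p] is a nonempty word of that color, and it cannot run
    over into [m], which starts with another color or none. *)
Lemma rewrite1_free_split i (p : seq (X i)) m w : starts_off i m ->
  rewrite1 free_rules (block p ++ m) w ->
  (exists2 m', rewrite1 free_rules m m' & w = block p ++ m') \/
  (exists2 p', rewrite1 (@Q i) p p' & w = block p' ++ m).
Proof.
move=> fm [x1 [x2 [u [v [hr eq1 ->]]]]].
move: (hr) => /free_rulesP [j [u0 [v0 [h [uE vE]]]]].
have right_step k : x1 = block p ++ k -> m = k ++ u ++ x2 ->
    exists2 m', rewrite1 free_rules m m' & x1 ++ v ++ x2 = block p ++ m'.
  move=> -> ->; exists (k ++ v ++ x2); last by rewrite -catA.
  by exists k, x2, u, v.
case: (eq_cat eq1) => [] [k [h1 h2]]; last by left; exact: right_step h1 h2.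
have [p0 [p1 [pE x1E kE]]] := block_eq_cat h1.
case: p1 => [|x p1] in pE kE.
  by left; apply: (right_step [::]); rewrite ?pE ?x1E ?cats0 // h2 kE.
right; subst k u v x1 p.
case: u0 h h2 {eq1 right_step h1} hr => [/(terminating_nil (@termQ j))//|y u0] h h2 hr.
have ij : j = i by case: h2.
subst j.
have [z [uz x2E]] : exists z, x :: p1 = (y :: u0) ++ z /\ x2 = block z ++ m.
  case: (eq_cat h2) => [] [z [hz1 hz2]]; last first.
    have [q0 [z0 [e1 e2 e3]]] := block_eq_cat hz1.
    by exists z0; rewrite e1 hz2 e3 -(block_inj e2).
  have [q0 [z0 [e1 e2 e3]]] := block_eq_cat hz1.
  move: fm; rewrite hz2 e3 => /block_starts_off z00; exists [::].
  by rewrite cats0 e1 z00 cats0 -(block_inj e2).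
exists (p0 ++ v0 ++ z); first by exists p0, z, (y :: u0), v0; rewrite uz.
by rewrite x2E !block_cat !catA.
Qed.

(** * Free steps combined with changes of a prefix *)

Section Prefix.
Variables (i : I) (D : seq (X i) -> seq (X i) -> Prop).
Hypothesis D_wf : well_founded (fun p' p => D p p').
Hypothesis D_cat : forall p p' z, D p p' -> D (p ++ z) (p' ++ z).
Hypothesis D_step : forall p p', rewrite1 (@Q i) p p' -> D p p'.

(** This models the word right of an edge letter: passing that letter changes a prefix over [X i] by
    [D], which may be more than a step of [Q i]. *)
Definition prefix_step (w w' : seq letter) : Prop :=
  rewrite1 free_rules w w' \/
  exists (p p' : seq (X i)) m, [/\ w = block p ++ m, w' = block p' ++ m & D p p'].

(* A step that empties or changes a block never creates a color change; when the
   tail comes to start with color [i], its first block merges with the prefix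
   and the number of color changes in the tail drops. *)
Lemma prefix_step_acc_le n :
  (forall m, changes m < n -> Acc (fun y x => rewrite1 free_rules x y) m) ->
  forall k, k <= n -> forall (p : seq (X i)) m, changes m < k -> starts_off i m ->
  Acc (fun y x => prefix_step x y) (block p ++ m).
Proof.
(* Lexicographic induction: on the bound [k] for the changes of the tail, on [p] along [D], on [m]
   along free steps. *)
move=> accm; elim=> [//|k IHk] kn p; elim: (D_wf p) => {}p _ IHp m mk fm.
have := accm _ (leq_trans mk kn); move=> acc_m.
elim: acc_m mk fm => {}m _ IHm mk fm; constructor=> w.
case=> [|[p0 [p0' [m0 [eq1 -> Dp]]]]].
  move=> /(rewrite1_free_split fm) [[m' mm' ->]|[p' pp' ->]]; last first.
    by apply: IHp => //; exact: D_step.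
  have cm' := changes_rewrite1 mm'.
  (* If the new tail still starts off [i], the innermost induction applies; otherwise its first
     block joins [p] and the remaining tail has fewer changes. *)
  have [[[|x p2] m2] /= [m'E fm2]] := split_ex i m'.
    by rewrite m'E in mm' cm' *; apply: IHm; [|exact: leq_ltn_trans cm' mk|].
  rewrite -[RHS]/(block (x :: p2) ++ m2) in m'E.
  rewrite m'E catA -block_cat.
  apply: IHk => //; first exact: ltnW.
  by apply: leq_trans (changes_starts_off x p2 fm2) _; rewrite -m'E (leq_trans cm').
(* The prefix changed by [D] is either an initial part of [p], where [D_cat] applies, or all of [p],
   since no longer prefix is a word over [X i]. *)
case: (eq_cat eq1) => [] [k0 [h1 h2]].
  have [q0 [z [pE /block_inj q0E zE]]] := block_eq_cat h1.
  rewrite h2 zE catA -block_cat; apply: IHp => //.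
  by rewrite pE -q0E; exact: D_cat.
have [q0 [z [pE /block_inj q0E zE]]] := block_eq_cat h1.
move: (fm); rewrite h2 zE => /block_starts_off z0.
rewrite z0 cats0 in pE; rewrite z0 in zE; rewrite zE /= in h2.
by rewrite -h2; apply: IHp => //; rewrite q0E -pE.
Qed.

End Prefix.

(** Induction on the number of color changes: the first maximal block stands before a tail with
    fewer changes, which is accessible by hypothesis. *)
Lemma free_rules_wf : well_founded (fun y x => rewrite1 free_rules x y).
Proof.
move=> w; have [n] := ubnP (changes w); elim: n w => [//|n IHn].
elim=> [_|[[i x]|e] w IHw /=].
- constructor=> y [x1 [x2 [u [v [hr e _]]]]].
  have u0 : u = [::] by case: x1 u e {hr} => [|//] [].
  move: hr; rewrite u0 => /free_rulesP [i [u1 [v1 [h [ue _]]]]].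
  by case: u1 ue h => [_ /(terminating_nil (@termQ i))|].
- rewrite ltnS => wn.
  have [[p m] /= [wE fm]] := split_ex i w.
  have cm : changes m < n by have := changes_starts_off x p fm; rewrite /= -wE => /leq_trans; apply.
  have -> : inl (existT X i x) :: w = block (x :: p) ++ m by rewrite /= wE.
  have acc : Acc (fun y x => prefix_step (rewrite1 (@Q i)) x y) (block (x :: p) ++ m).
    apply: (@prefix_step_acc_le i (rewrite1 (@Q i)) _ _ _ n IHn n (leqnn n) _ _ cm fm).
    - exact/terminating_wf/(@termQ i).
    - by move=> p1 p2 z; exact: rewrite1_catr.
    - by [].
  elim: acc => w' _ IH; constructor=> y wy; apply: IH; by left.
(* An inert letter need not add a change, so here the induction on the word is used. *)
- rewrite ltnS => wn.
  have {IHw} : Acc (fun y x => rewrite1 free_rules x y) w.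
    by apply: IHw; rewrite ltnS; exact: leq_trans (leq_addl _ _) wn.
  elim=> {wn}w _ IH; constructor=> y.
  case=> [[|l x1] [x2 [u [v [/free_rulesP [i [u0 [v0 [h [-> ->]]]]] eq1 ->]]]]].
    by move: eq1 h; case: u0 => [_ /(terminating_nil (@termQ i))|].
  case: eq1 => <- wE; apply: IH; exists x1, x2, (block u0), (block v0).
  by split=> //; apply/free_rulesP; exists i, u0, v0.
Qed.

Lemma prefix_step_wf i (D : seq (X i) -> seq (X i) -> Prop) :
  well_founded (fun p' p => D p p') ->
  (forall p p' z, D p p' -> D (p ++ z) (p' ++ z)) ->
  (forall p p', rewrite1 (@Q i) p p' -> D p p') ->
  well_founded (fun y x => prefix_step D x y).
Proof.
move=> h1 h2 h3 w; have [[p m] /= [-> fm]] := split_ex i w.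
refine (prefix_step_acc_le h1 h2 h3 _ (leqnn (changes m).+1) _ (leqnn _) fm).
by move=> m' _; exact: free_rules_wf.
Qed.

End FreeProduct.
Lemma multiplicative1 (C G : groupType) (d : {multiplicative C -> G}) : d 1 = 1.
Proof. by apply: (mulgI (d 1)); rewrite -gmulfM !mulg1. Qed.

Lemma multiplicativeV (C G : groupType) (d : {multiplicative C -> G}) x :
  d x^-1 = (d x)^-1.
Proof. by apply: (mulgI (d x)); rewrite -gmulfM !mulgV multiplicative1. Qed.

(** * Coset representatives from left compatibility *)

Section Edge.
Variables (G : groupType) (X : finType) (Q : rules X) (rho : seq X -> G).
Hypothesis fc : is_fcrs Q rho.
Variables (Y : finType) (piY : seq Y -> G) (RY : rules (ext_alphabet X Y)).
Variables (C : groupType) (d : {multiplicative C -> G}).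
Hypothesis d_inj : injective d.
Hypothesis piY_mor : word_morphism piY.
Hypothesis piY_range : range piY = range d.
Hypothesis RY_term : terminating (ext_rules Q RY).
Hypothesis RY_form : forall r, RY r -> exists u v w,
  r = (ext_t X Y :: ext_l Y u, ext_r X v ++ ext_t X Y :: ext_l Y w)
  /\ rho u = piY v * rho w.
Definition edge_irr (p : seq X) := irreducible (ext_rules Q RY) (ext_t X Y :: ext_l Y p).
Hypothesis RY_coset : forall u v, edge_irr u -> edge_irr v ->
  u = v <-> right_coset (range d) (rho u) = right_coset (range d) (rho v).

(* The word emitted to the left of t is forgotten. *)
Definition edge_step (p p' : seq X) := exists v,
  rewrite1 (ext_rules Q RY) (ext_t X Y :: ext_l Y p) (ext_r X v ++ ext_t X Y :: ext_l Y p').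

Lemma ext_l_cat (p q : seq X) : ext_l Y (p ++ q) = ext_l Y p ++ ext_l Y q.
Proof. exact: map_cat. Qed.

Lemma ext_l_inj : injective (@ext_l X Y).
Proof. by apply: inj_map => a b []. Qed.

Lemma ext_r_cat (p q : seq Y) : ext_r X (p ++ q) = ext_r X p ++ ext_r X q.
Proof. exact: map_cat. Qed.

(** Putting the emitted words [V] back on the left of [t] turns a chain of edge steps into a chain
    of the extended system. *)
Lemma edge_step_wf : well_founded (fun p' p => edge_step p p').
Proof.
have acc x : Acc (fun y x => rewrite1 (ext_rules Q RY) x y) x ->
    forall p V, ext_r X V ++ ext_t X Y :: ext_l Y p = x ->
    Acc (fun p' p => edge_step p p') p.
  elim=> {}x _ IH p V xE; constructor=> p' [v pp'].
  refine (IH (ext_r X (V ++ v) ++ ext_t X Y :: ext_l Y p') _ p' (V ++ v) erefl).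
  by rewrite -xE ext_r_cat -catA; exact: rewrite1_catl.
move=> p; exact: (acc _ ((terminating_wf _).1 RY_term _) p [::] erefl).
Qed.

Lemma edge_step_cat p p' z : edge_step p p' -> edge_step (p ++ z) (p' ++ z).
Proof.
by case=> v /(rewrite1_catr (ext_l Y z)); rewrite /= -catA /= -!ext_l_cat; exists v.
Qed.

Lemma rewrite1_ext p p' : rewrite1 Q p p' ->
  rewrite1 (ext_rules Q RY) (ext_l Y p) (ext_l Y p').
Proof.
case=> x1 [x2 [u [v [h -> ->]]]]; exists (ext_l Y x1), (ext_l Y x2), (ext_l Y u), (ext_l Y v).
by rewrite !ext_l_cat; split=> //; left; exists (u, v).
Qed.

Lemma edge_step_rewrite1 p p' : rewrite1 Q p p' -> edge_step p p'.
Proof. by move=> h; exists [::]; exact: (rewrite1_catl [:: _] (rewrite1_ext h)). Qed.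

Lemma edge_step_rule u v w : RY (ext_t X Y :: ext_l Y u, ext_r X v ++ ext_t X Y :: ext_l Y w) ->
  edge_step u w.
Proof. by move=> h; exists v; apply: rewrite1_rule; right. Qed.

(** As [t] occurs only at the front, a rule of [RY] can act only there and a rule of [Q] only to its
    right; both keep the element of [G] read off when [t] is erased. *)
Lemma rewrite1_extP p z : rewrite1 (ext_rules Q RY) (ext_t X Y :: ext_l Y p) z ->
  exists v p', z = ext_r X v ++ ext_t X Y :: ext_l Y p' /\ rho p = piY v * rho p'.
Proof.
have tQ := fcrs_term fc.
case=> [[|y x1] [x2 [u [v [[[[u0 v0] h [uE vE]]|h] e ->]]]]].
- by move: e h; rewrite -uE; case: u0 {uE} => [_ /(terminating_nil tQ)|].
- have [u0 [v0 [w [[uE vE] hr]]]] := RY_form h.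
  move: e; rewrite uE vE => -[/map_eq_cat [p1 [p2 [-> h1 ->]]]].
  have -> : p1 = u0 by exact/esym/ext_l_inj.
  exists v0, (w ++ p2); split; first by rewrite -catA /= ext_l_cat.
  by rewrite !(fcrsM fc) hr mulgA.
- case: e => <- /map_eq_cat [p1 [p2 [-> -> /esym/map_eq_cat [u1 [p3 [-> h1 ->]]]]]].
  have {}h1 : u0 = u1 by apply: ext_l_inj; rewrite uE h1.
  exists [::], (p1 ++ v0 ++ p3); split; first by rewrite -vE !ext_l_cat.
  rewrite piY_mor.1 mul1g !(fcrsM fc) -h1.
  by rewrite ((fcrs_congr fc _ _).2 (congruence_rule h)).
- have [u0 [v0 [w [[uE vE] hr]]]] := RY_form h.
  case: e => _ /map_eq_cat [p1 [p2 [_ _ /esym]]].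
  by rewrite uE; case: p2.
Qed.

Lemma edge_irrP p : ~ edge_irr p -> exists v p',
  rewrite1 (ext_rules Q RY) (ext_t X Y :: ext_l Y p) (ext_r X v ++ ext_t X Y :: ext_l Y p')
  /\ rho p = piY v * rho p'.
Proof.
move=> /contrapT [z [_ h]]; have [v [p' [zE hp]]] := rewrite1_extP h.
by exists v, p'; rewrite -zE.
Qed.

(** The emitted words multiply up to the element of the subgroup that separates [p] from the
    representative [w] of its coset. *)
Lemma edge_reduce p : exists v w, [/\ edge_irr w, rho p = piY v * rho w &
  rewrites (ext_rules Q RY) (ext_t X Y :: ext_l Y p) (ext_r X v ++ ext_t X Y :: ext_l Y w)].
Proof.
elim: (edge_step_wf p) => {}p _ IH.
have [ip|/edge_irrP [v [p' [h hp]]]] := pselect (edge_irr p).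
  by exists [::], p; rewrite piY_mor.1 mul1g; split=> //; exact: rt_refl.
have [|v' [w [iw hw r]]] := IH p'; first by exists v.
exists (v ++ v'), w; split=> //; first by rewrite piY_mor.2 hp hw mulgA.
apply: rewrites_trans (rt_step _ _ _ _ h) _.
rewrite ext_r_cat -catA; move: r; apply: rewrites_map => x y.
exact: rewrite1_catl.
Qed.

(** A step from [t] to [v t w] would give an edge step from [z] to [w ++ z] for every [z], hence an
    infinite chain. *)
Lemma edge_irr_nil : edge_irr [::].
Proof.
apply: contrapT => /edge_irrP [v [w [h _]]].
have st z : edge_step z (w ++ z).
  by apply: (@edge_step_cat [::]); exists v.
by have := edge_step_wf [::]; elim=> z _ /(_ _ (st z)).
Qed.

Lemma edge_irr_irreducible p : edge_irr p -> irreducible Q p.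
Proof.
move=> ip [p' [pp' /rewrite1_ext/(rewrite1_catl [:: ext_t X Y]) h]]; apply: ip.
exists (ext_t X Y :: ext_l Y p'); by split=> // -[/ext_l_inj/pp'].
Qed.

Lemma piY_d v : exists g, piY v = d g.
Proof.
have : range piY (piY v) by exists v.
by rewrite piY_range => -[g _ <-]; exists g.
Qed.

Lemma edge_irr_uniq p p' g : edge_irr p -> edge_irr p' -> rho p' = d g * rho p -> p' = p.
Proof.
move=> ip ip' h; apply/(RY_coset ip' ip)/seteqP.
rewrite h; split=> _ [_ [k _ <-] <-].
  by exists (d (k * g)); [exists (k * g)|rewrite gmulfM mulgA].
exists (d (k * g^-1)); first by exists (k * g^-1).
by rewrite gmulfM multiplicativeV mulgA mulgVK.
Qed.

Lemma rep_ex h : exists pg : seq X * C, edge_irr pg.1 /\ h = d pg.2 * rho pg.1.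
Proof.
have [p <-] := fcrs_surj fc h; have [v [w [iw hp _]]] := edge_reduce p.
by have [g hg] := piY_d v; exists (w, g); rewrite /= -hg.
Qed.

(** A transversal of the right cosets of the image of [d] by irreducible words, with the cofactor
    [repg] taken in the edge group itself. *)
Definition rep h := (sval (cid (rep_ex h))).1.
Definition repg h := (sval (cid (rep_ex h))).2.

Lemma rep_irr h : edge_irr (rep h).
Proof. by rewrite /rep; case: cid => ? []. Qed.

Lemma repE h : h = d (repg h) * rho (rep h).
Proof. by rewrite {1}/rep /repg; case: cid => ? []. Qed.

(** [RY_coset] fixes the representative, and injectivity of [d] then fixes the cofactor. *)
Lemma rep_uniq h g p : edge_irr p -> h = d g * rho p -> rep h = p /\ repg h = g.
Proof.
move=> ip hE.
have rp : rep h = p.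
  refine (@edge_irr_uniq _ _ ((repg h)^-1 * g) ip (@rep_irr h) _).
  apply: (mulgI (d (repg h))); rewrite -repE hE mulgA gmulfM multiplicativeV mulgA.
  by rewrite mulgV mul1g.
split=> //; apply: d_inj; apply: (mulIg (rho p)).
by rewrite -hE {2}(repE h) rp.
Qed.

Lemma rep_rho p : edge_irr p -> rep (rho p) = p /\ repg (rho p) = 1.
Proof. by move=> ip; apply: rep_uniq => //; rewrite multiplicative1 mul1g. Qed.

Lemma rep_mul g h : rep (d g * h) = rep h /\ repg (d g * h) = g * repg h.
Proof.
apply: rep_uniq; first exact: rep_irr.
by rewrite gmulfM -mulgA -repE.
Qed.

End Edge.
(** * The rewriting system of the fundamental group *)

Section GraphOfRewritingSystems.
Variables (Gamma : finite_graph) (GG : graph_of_groups Gamma).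
Local Notation V := (vertex Gamma).
Local Notation rev := (@rev_edge Gamma).
Local Notation o := (@orig Gamma).
Local Notation bd := (boundary GG).
Variables (X : V -> finType) (Q : forall v, rules (X v)).
Variable rho : forall v, seq (X v) -> vertex_group GG v.
Hypothesis fc : forall v, is_fcrs (@Q v) (@rho v).
Variables (Y : edge Gamma -> finType).
Variable piY : forall e, seq (Y e) -> vertex_group GG (o e).
Variable RY : forall e, rules (ext_alphabet (X (o e)) (Y e)).
Hypothesis piY_mor : forall e, word_morphism (@piY e).
Hypothesis piY_range : forall e, range (@piY e) = range (bd e).
Hypothesis RY_fin : forall e, finite_set (@RY e).
Hypothesis RY_term : forall e, terminating (ext_rules (@Q (o e)) (@RY e)).
Hypothesis RY_form : forall e r, @RY e r -> exists u v w,
  r = (ext_t (X (o e)) (Y e) :: ext_l (Y e) u,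
       ext_r (X (o e)) v ++ ext_t (X (o e)) (Y e) :: ext_l (Y e) w)
  /\ rho u = piY v * rho w.
Hypothesis RY_coset : forall e u v,
  edge_irr (@Q (o e)) (@RY e) u -> edge_irr (@Q (o e)) (@RY e) v ->
  u = v <-> right_coset (range (bd e)) (rho u) = right_coset (range (bd e)) (rho v).

Local Notation L := (letter X (edge Gamma)).
Local Notation block := (@block V X (edge Gamma) _).
Local Notation starts_off := (@starts_off V X (edge Gamma)).
Local Notation FR := (@free_rules V X (edge Gamma) Q).

(** * Identification of the groups of opposite edges *)

Lemma rev_elt1 e : rev_elt (1 : edge_group GG e) = 1.
Proof.
rewrite /rev_elt; move: (edge_group_rev GG e); move: (edge_group GG (rev e)) => H E.
by case: _ / E.
Qed.

Lemma rev_eltM e (g h : edge_group GG e) : rev_elt (g * h) = rev_elt g * rev_elt h.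
Proof.
rewrite /rev_elt; move: (edge_group_rev GG e); move: (edge_group GG (rev e)) => H E.
by case: _ / E.
Qed.

(** The two elements have different types, hence the dependent pairs. Once the first equality of
    groups is eliminated, the second is a loop, trivial by proof irrelevance. *)
Lemma rev_eltK e (g : edge_group GG e) :
  existT (fun f => edge_group GG f : Type) (rev (rev e)) (rev_elt (rev_elt g)) =
  existT (fun f => edge_group GG f : Type) e g.
Proof.
rewrite /rev_elt; move: (edge_group_rev GG (rev e)) (rev_edgeK e).
move: (rev (rev e)) => f E2 ef; subst f.
move: (edge_group_rev GG e) E2; move: (edge_group GG (rev e)) => H E1.
by case: _ / E1 => E2; rewrite (Prop_irrelevance E2 erefl).
Qed.

Lemma carry_ex e (y : Y e) : exists w : seq (X (o (rev e))), exists g,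
  piY [:: y] = bd e g /\ rho w = bd (rev e) (rev_elt g).
Proof.
have [g hg] := piY_d (piY_range e) [:: y].
by have [w hw] := fcrs_surj (fc (o (rev e))) (bd (rev e) (rev_elt g)); exists w, g.
Qed.

(* [piY v] lies in d_e(G_e); [carry v] spells the corresponding element of
   d_(rev e)(G_e). *)
Definition carry e (v : seq (Y e)) : seq (X (o (rev e))) :=
  flatten [seq sval (cid (carry_ex y)) | y <- v].

Lemma carry_cat e (v w : seq (Y e)) : carry (v ++ w) = carry v ++ carry w.
Proof. by rewrite /carry map_cat flatten_cat. Qed.

(** Each letter is carried with a matching edge element, and the products of these match at both
    ends. *)
Lemma carryP e (v : seq (Y e)) : exists g,
  piY v = bd e g /\ rho (carry v) = bd (rev e) (rev_elt g).
Proof.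
elim: v => [|y v [g [hv hcv]]].
  by exists 1; rewrite (piY_mor e).1 (fcrs1 (fc _)) rev_elt1 !multiplicative1.
have [g' [hy hcy]] : exists g, piY [:: y] = bd e g /\
    rho (sval (cid (carry_ex y))) = bd (rev e) (rev_elt g) by case: cid.
exists (g' * g); rewrite (fcrsM (fc _)) -/(carry v) hcv hcy rev_eltM !gmulfM; split=> //.
by rewrite -cat1s (piY_mor e).2 hy hv.
Qed.

(* The letter [inr e] stands for t_e^-1, which moves d_e(G_e) on its right to
   d_(rev e)(G_e) on its left. *)
Definition transfer1 e (l : ext_alphabet (X (o e)) (Y e)) : seq L :=
  match l with
  | inl (inl x) => block [:: x]
  | inl (inr y) => block (carry [:: y])
  | inr _ => [:: inr e]
  end.
(** A morphism of free monoids from the extended alphabet at [e], along which reductions there are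
    replayed in the system for F. *)
Definition transfer e (w : seq (ext_alphabet (X (o e)) (Y e))) : seq L :=
  flatten (map (@transfer1 e) w).

Lemma transfer_cat e a b : @transfer e (a ++ b) = transfer a ++ transfer b.
Proof. by rewrite /transfer map_cat flatten_cat. Qed.

Lemma transfer_l e p : @transfer e (ext_l _ p) = block p.
Proof. by elim: p => //= x p; rewrite /transfer /= => ->. Qed.

Lemma transfer_r e v : @transfer e (ext_r _ v) = block (carry v).
Proof.
elim: v => // y v IH; rewrite -(cat1s y v) ext_r_cat transfer_cat IH carry_cat block_cat.
by congr (_ ++ _); rewrite /transfer /= cats0.
Qed.

Lemma transfer_t e w : @transfer e (ext_t _ _ :: w) = inr e :: transfer w. Proof. by []. Qed.

Definition F_rules : rules L :=
  FR `|` (\bigcup_e [set (transfer r.1, transfer r.2) | r in @RY e])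
  `|` (\bigcup_e [set ([:: inr (rev e); inr e], [::])]).

Variant F_rules_spec : seq L -> seq L -> Prop :=
| RuleVertex i u v of @Q i (u, v) : F_rules_spec (block u) (block v)
| RuleEdge e u v w of
    @RY e (ext_t _ _ :: ext_l _ u, ext_r _ v ++ ext_t _ _ :: ext_l _ w)
    & rho u = piY v * rho w :
    F_rules_spec (inr e :: block u) (block (carry v) ++ inr e :: block w)
| RuleCancel e : F_rules_spec [:: inr (rev e); inr e] [::].

Lemma F_rulesP l r : F_rules (l, r) -> F_rules_spec l r.
Proof.
case=> [[/free_rulesP [i [u [v [h [-> ->]]]]]|[e _ [[a b] h [<- <-]]]]|[e _ [-> ->]]].
- exact: RuleVertex.
- have [u [v [w [[aE bE] hr]]]] := RY_form h; rewrite /= aE bE in h *.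
  by rewrite transfer_cat !transfer_t !transfer_l transfer_r; exact: RuleEdge.
- exact: RuleCancel.
Qed.

Lemma F_rules_fin : finite_set F_rules.
Proof.
rewrite !finite_setU; split; first split.
- apply: bigcup_finite => // i _; apply: finite_image.
  by case: (fc i).
- apply: bigcup_finite => // e _; exact: finite_image.
- apply: bigcup_finite => // e _; exact: finite_set1.
Qed.

Lemma rewrite1_vertex i p q : rewrite1 (@Q i) p q -> rewrite1 F_rules (block p) (block q).
Proof.
move=> /(rewrite1_free (edge Gamma)) [x1 [x2 [u [v [h -> ->]]]]].
by exists x1, x2, u, v; split=> //; left; left.
Qed.

Lemma rewrite1_transfer e x y : rewrite1 (ext_rules (@Q (o e)) (@RY e)) x y ->
  rewrite1 F_rules (transfer x) (transfer y).
Proof.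
case=> x1 [x2 [u [v [h -> ->]]]]; exists (transfer x1), (transfer x2), (transfer u), (transfer v).
rewrite !transfer_cat; split=> //; case: h => [[[u0 v0] h [<- <-]]|h].
  by left; left; rewrite !transfer_l; apply/free_rulesP; exists (o e), u0, v0.
by left; right; exists e => //; exists (u, v).
Qed.

(** * Termination *)

Definition edges (w : seq L) := count (fun l => if l is inr _ then true else false) w.

Lemma edges_cat a b : edges (a ++ b) = edges a + edges b. Proof. exact: count_cat. Qed.

Lemma edges_block i (p : seq (X i)) : edges (block p) = 0.
Proof. by elim: p. Qed.

Lemma rewrite1_edges x y : rewrite1 F_rules x y -> edges y <= edges x.
Proof.
case=> x1 [x2 [l [r [/F_rulesP h -> ->]]]]; rewrite !edges_cat leq_add2l leq_add2r.
by case: h => *; rewrite ?edges_cat /= ?edges_block.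
Qed.

Lemma rewrite1_edges0 x y : edges x = 0 -> rewrite1 F_rules x y -> rewrite1 FR x y.
Proof.
move=> nx [x1 [x2 [l [r [/F_rulesP h xE ->]]]]].
move: nx; rewrite xE !edges_cat; case: h => [i u v h _|e u v w _ _|e] /=.
- by exists x1, x2, (block u), (block v); split=> //; apply/free_rulesP; exists i, u, v.
- by rewrite addnS.
- by rewrite addnS.
Qed.

Lemma edges_split w : edges w <> 0 -> exists a e b, w = a ++ inr e :: b /\ edges b = 0.
Proof.
elim: w => // l w IH; have [/eqP w0|/eqP /IH [a [e [b [-> nb]]]] _] := boolP (edges w == 0).
  by case: l => [x|e] /=; rewrite ?w0 // => _; exists [::], e, w.
by exists (l :: a), e, b.
Qed.

(** With the word cut at its last edge letter as [a ++ inr e :: b], the induction is lexicographic: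
    on the number of edge letters, on [b] along [prefix_step], and on [a]. *)
Lemma F_rules_term : terminating F_rules.
Proof.
have Qterm i : terminating (@Q i) by exact: fcrs_term (fc i).
apply/terminating_wf => w; have [n] := ubnP (edges w); elim: n w => [//|n IHn w].
rewrite ltnS => wn.
have [/eqP w0|/eqP /edges_split [a [e [b [wE nb]]]]] := boolP (edges w == 0).
  have acc := @free_rules_wf _ _ (edge Gamma) _ Qterm w.
  elim: acc w0 {wn} => {}w _ IH w0; constructor=> y wy.
  apply: (IH y (rewrite1_edges0 w0 wy)).
  by apply/eqP; have := rewrite1_edges wy; rewrite w0 leqn0.
have accb : well_founded (fun y (x : seq L) => prefix_step Q (edge_step (@Q (o e)) (@RY e)) x y).
  refine (@prefix_step_wf _ _ _ _ Qterm _ _ _ _ _).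
  - exact: edge_step_wf (@RY_term e).
  - by move=> p p' z; exact: edge_step_cat.
  - by move=> p p'; exact: edge_step_rewrite1.
move: wn; rewrite {w}wE; elim: (accb b) a nb => {}b _ IHb a nb.
rewrite edges_cat /= nb addn0 addn1 => an.
(* [a] has fewer edge letters, so it is accessible. It is universally quantified in [IHb], because
   an edge rule appends letters to it. *)
have := IHn a an; move=> acca; elim: acca an => {}a _ IHa an; constructor=> y.
case=> x1 [x2 [l [r [hr eq1 ->]]]].
have inside_a k : a = x1 ++ l ++ k -> x2 = k ++ inr e :: b ->
    Acc (fun y x => rewrite1 F_rules x y) (x1 ++ r ++ x2).
  move=> aE ->; rewrite !catA -(catA x1 r k).
  have st : rewrite1 F_rules a (x1 ++ r ++ k) by exists x1, k, l, r.
  by apply: IHa => //; exact: leq_ltn_trans (rewrite1_edges st) an.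
have at_b k : x1 = a ++ k -> inr e :: b = k ++ l ++ x2 ->
    Acc (fun y x => rewrite1 F_rules x y) (x1 ++ r ++ x2).
  move=> ->; case: k => [|s k].
    rewrite cats0 /=; case: (F_rulesP hr) => [i u v h|f u v z h _|f] /=.
    - by case: u h => [/(terminating_nil (@Qterm i))|].
    (* The edge rule fires at the last edge letter: a prefix of [b] makes an edge step and the
       carried word joins [a]. *)
    - case=> fe bE; subst f; rewrite -!catA /= catA.
      have x20 : edges x2 = 0 by move: nb; rewrite bE edges_cat edges_block.
      apply: IHb; last by rewrite !edges_cat /= edges_cat !edges_block x20 addn0 addn1.
        by right; exists u, z, x2; split=> //; exact: edge_step_rule h.
      by rewrite edges_cat edges_block x20.
    - by case=> _ bE; move: nb; rewrite bE.
  case=> <- bE; have st : rewrite1 F_rules b (k ++ r ++ x2) by exists k, x2, l, r.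
  rewrite -catA /=; apply: IHb; first by left; exact: rewrite1_edges0.
    by apply/eqP; have := rewrite1_edges st; rewrite nb leqn0.
  have := rewrite1_edges st; rewrite nb leqn0 => /eqP nk.
  by rewrite edges_cat /= nk addn0 addn1.
case: (eq_cat eq1) => [] [k [h1 h2]]; last exact: at_b h1 h2.
case: (eq_cat h2) => [] [m [h3 h4]]; last by apply: inside_a h4; rewrite h1 h3.
case: m h3 h4 => [|s m] h3 h4; first by apply: (inside_a [::]); rewrite ?h1 ?h3 ?cats0.
case: h4 => se bE; subst s.
case: k h1 h2 h3 => [|s k] h1 h2 h3; first by apply: (at_b [::]); rewrite ?cats0 // h1 cats0.
case: (F_rulesP hr) h3 => [i u v _ /block_eq_cat [p1 [p2 [_ _]]]
  |f u v z _ _ [_ /block_eq_cat [p1 [p2 [_ _]]]]|f [_]].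
- by case: p2.
- by case: p2.
(* Only a cancellation can start in [a] and reach the last edge letter; it lowers the number of edge
   letters. *)
- move=> kE; have [k0 m0] : k = [::] /\ m = [::].
    by move: kE; clear; case: k => [[_ <-]|? []].
  rewrite bE m0 /= in nb; apply: IHn.
  by rewrite !edges_cat nb /= !addn0; apply: leq_ltn_trans an; rewrite h1 edges_cat leq_addr.
Qed.

(** * The action on normal words *)

(** [pre] is the maximal prefix over [X v], which makes the splitting unique. *)
Definition pre v (n : seq L) : seq (X v) := (sval (cid (split_ex v n))).1.
Definition post v (n : seq L) : seq L := (sval (cid (split_ex v n))).2.

Lemma splitE v n : n = block (pre v n) ++ post v n.
Proof. by rewrite /pre /post; case: cid => ? []. Qed.

Lemma post_starts_off v n : starts_off v (post v n).
Proof. by rewrite /post; case: cid => ? []. Qed.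

Lemma split_cat v (p : seq (X v)) m : starts_off v m ->
  pre v (block p ++ m) = p /\ post v (block p ++ m) = m.
Proof.
move=> fm; have h := splitE v (block p ++ m).
by have [<- <-] := split_uniq h fm (@post_starts_off v _).
Qed.

Lemma split_starts_off v m : starts_off v m -> pre v m = [::] /\ post v m = m.
Proof. exact: (@split_cat v [::]). Qed.

Lemma edge_starts_off v e m : starts_off v (inr e :: m). Proof. by []. Qed.

Local Notation irr_e e := (edge_irr (@Q (o e)) (@RY e)).
Local Notation rep_e e :=
  (@rep _ _ _ _ (fc (o e)) _ _ _ _ _ (@piY_mor e) (@piY_range e) (@RY_term e) (@RY_form e)).
Local Notation repg_e e :=
  (@repg _ _ _ _ (fc (o e)) _ _ _ _ _ (@piY_mor e) (@piY_range e) (@RY_term e) (@RY_form e)).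

Lemma rep_eM e g h : rep_e e (bd e g * h) = rep_e e h /\
  repg_e e (bd e g * h) = g * repg_e e h.
Proof. by apply: rep_mul; [exact: boundary_inj|exact: RY_coset]. Qed.

Lemma rep_e_rho e p : irr_e e p -> rep_e e (rho p) = p /\ repg_e e (rho p) = 1.
Proof. by apply: rep_rho; [exact: boundary_inj|exact: RY_coset]. Qed.

Lemma irr_e_nil e : irr_e e [::].
Proof. exact: (edge_irr_nil (fc (o e)) (@piY_mor e) (@RY_term e) (@RY_form e)). Qed.

Lemma rep_e1 e : rep_e e 1 = [::] /\ repg_e e 1 = 1.
Proof. by rewrite -(fcrs1 (fc (o e))); apply: rep_e_rho; exact: irr_e_nil. Qed.

Lemma irr_nil v : irreducible (@Q v) [::].
Proof. exact: irreducible_nil (fcrs_term (fc v)). Qed.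

(** The analogue of normal forms in HNN extensions: a coset representative stands behind each edge
    letter, and no edge letter directly precedes its reverse. Blocks of any vertices may follow each
    other, as F is not restricted to paths in the graph. *)
Inductive normal : seq L -> Prop :=
| NormalNil : normal [::]
| NormalVertex v (p : seq (X v)) m of normal m & starts_off v m & irreducible (@Q v) p :
    normal (block p ++ m)
| NormalEdge e n of normal n & irr_e e (pre (o e) n)
    & (forall m, n <> inr (rev e) :: m) : normal (inr e :: n).

Lemma normal_split v n : normal n -> normal (post v n) /\ irreducible (@Q v) (pre v n).
Proof.
elim=> {n} [|w p m nm IH fm ip|e n nn _ ie he].
- have [|-> ->] := @split_starts_off v [::] => //; split; [exact: NormalNil|exact: irr_nil].
- have [vw|vw] := eqVneq w v.
    by subst w; have [-> ->] := split_cat p fm.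
  case: p ip => [//|x p] ip.
  have [y m' [wv _]|-> ->] := @split_starts_off v (block (x :: p) ++ m).
    by rewrite wv eqxx in vw.
  by split; [exact: NormalVertex|exact: irr_nil].
- have [//|-> ->] := @split_starts_off v (inr e :: n).
  by split; [exact: NormalEdge|exact: irr_nil].
Qed.

(** [NormalVertex] with an empty block returns the same word, so this inversion needs an
    induction. *)
Lemma normal_edge e n : normal (inr e :: n) ->
  [/\ normal n, irr_e e (pre (o e) n) & forall m, n <> inr (rev e) :: m].
Proof.
move=> h; move: {-2}(inr e :: n) h (erefl (inr e :: n : seq L)) => z.
elim=> {z} [//|v [|x p] m nm IH fm ip //=|f n' nn _ ie he []].
by move=> ef nE; subst f n'.
Qed.

(** Left multiplication by an element of a vertex group, in terms of normal words. *)
Definition act v (g : vertex_group GG v) (n : seq L) : seq L :=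
  block (fcrs_nf (fc v) (g * rho (pre v n))) ++ post v n.

Lemma act_cat v g (p : seq (X v)) m : starts_off v m ->
  act g (block p ++ m) = block (fcrs_nf (fc v) (g * rho p)) ++ m.
Proof. by move=> fm; rewrite /act; have [-> ->] := split_cat p fm. Qed.

Lemma act_starts_off v (g : vertex_group GG v) m : starts_off v m ->
  act g m = block (fcrs_nf (fc v) g) ++ m.
Proof. by move=> fm; have := @act_cat v g [::] m fm; rewrite (fcrs1 (fc v)) mulg1. Qed.

Lemma actM v (g h : vertex_group GG v) n : act g (act h n) = act (g * h) n.
Proof. by rewrite {2}/act act_cat ?fcrs_nfK ?mulgA //; exact: post_starts_off. Qed.

Lemma act1 v n : normal n -> act (1 : vertex_group GG v) n = n.
Proof.
by move=> /(normal_split v) [_ ip]; rewrite /act mul1g irr_fcrs_nf // -splitE.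
Qed.

Lemma act_normal v (g : vertex_group GG v) n : normal n -> normal (act g n).
Proof.
move=> /(normal_split v) [np _]; apply: NormalVertex => //; first exact: post_starts_off.
exact: fcrs_nf_irr.
Qed.

(* The reduced form of t_e^-1 p m. *)
Definition attach e (p : seq (X (o e))) (m : seq L) : seq L :=
  match p, m with
  | [::], inr f :: m' => if f == rev e then m' else inr e :: m
  | _, _ => inr e :: block p ++ m
  end.

Variant attach_spec e (p : seq (X (o e))) m : seq L -> Prop :=
| AttachCancel m' of p = [::] & m = inr (rev e) :: m' : attach_spec p m m'
| AttachCons of (forall m', block p ++ m <> inr (rev e) :: m') :
    attach_spec p m (inr e :: block p ++ m).

Lemma attachP e (p : seq (X (o e))) m : attach_spec p m (attach p m).
Proof.
case: p => [|x p]; last by right.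
case: m => [|[l|f] m]; [by right|by right|rewrite /=].
case: eqP => [->|fe]; first by left.
by right=> m' [fe'].
Qed.

(** Left multiplication by t_e^-1: the prefix is d_e(g) times its representative, and g crosses the
    edge letter to act at the other end. *)
Definition act_edge e (n : seq L) : seq L :=
  let h := rho (pre (o e) n) in
  act (bd (rev e) (rev_elt (repg_e e h))) (attach (rep_e e h) (post (o e) n)).

Lemma attach_normal e p m : normal m -> starts_off (o e) m -> irr_e e p ->
  normal (attach p m).
Proof.
move=> nm fm ip; case: attachP => [m' _ mE|h].
  by rewrite mE in nm; have [] := normal_edge nm.
apply: NormalEdge => //; last by have [->] := split_cat p fm.
apply: NormalVertex => //; exact: edge_irr_irreducible ip.
Qed.

Lemma act_edge_normal e n : normal n -> normal (act_edge e n).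
Proof.
move=> nn; apply/act_normal/attach_normal.
- by have [] := normal_split (o e) nn.
- exact: post_starts_off.
- exact: rep_irr.
Qed.

(** The prefix of [n] is already its own representative, so the factor to be carried across is 1. *)
Lemma act_edge_cons e n : normal (inr e :: n) -> act_edge e n = inr e :: n.
Proof.
move=> ne; have [nn ie he] := normal_edge ne.
rewrite /act_edge; have [-> ->] := rep_e_rho ie.
rewrite rev_elt1 multiplicative1.
have -> : attach (pre (o e) n) (post (o e) n) = inr e :: n.
  case: attachP => [m' p0 mE|]; last by rewrite -splitE.
  by have := splitE (o e) n; rewrite p0 mE => /he.
exact: act1.
Qed.

(** Multiplying the prefix by d_e(g) keeps its representative and only multiplies the cofactor by
    g. *)
Lemma act_edge_conj e (g : edge_group GG e) n :
  act_edge e (act (bd e g) n) = act (bd (rev e) (rev_elt g)) (act_edge e n).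
Proof.
rewrite /act_edge {2 4}/act.
have [-> ->] := split_cat (fcrs_nf (fc (o e)) (bd e g * rho (pre (o e) n)))
  (@post_starts_off (o e) n).
by rewrite fcrs_nfK; have [-> ->] := rep_eM g (rho (pre (o e) n));
  rewrite actM rev_eltM gmulfM.
Qed.

(** Both actions take values in the same type of words, so the equality of dependent pairs maps
    through them. *)
Lemma act_revK e (g : edge_group GG e) n :
  act (bd (rev (rev e)) (rev_elt (rev_elt g))) n = act (bd e g) n.
Proof.
exact: (congr1 (fun t : {f & edge_group GG f : Type} =>
  act (bd (tag t) (tagged t)) n) (rev_eltK g)).
Qed.

(** The cofactor crosses the edge and returns, so what remains is that the second edge letter undoes
    [attach]. *)
Lemma act_edgeK e n : normal n -> act_edge (rev e) (act_edge e n) = n.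
Proof.
move=> nn; rewrite {2}/act_edge act_edge_conj act_revK.
set h := rho (pre (o e) n).
have [np ip] := normal_split (o e) nn.
have nE : block (fcrs_nf (fc (o e)) h) ++ post (o e) n = n.
  by rewrite irr_fcrs_nf // -splitE.
have hE := repE (fc (o e)) (@piY_mor e) (@piY_range e) (@RY_term e) (@RY_form e) h.
have ir := @rep_irr _ _ _ _ (fc (o e)) _ _ _ _ _ (@piY_mor e) (@piY_range e) (@RY_term e) (@RY_form e) h.
move: hE ir; case: attachP => [m' -> mE|_] hE ir.
  (* The first action cancelled a leading [inr (rev e)]; normality of the tail lets the second one
     restore it. *)
  rewrite mE in np; rewrite act_edge_cons // act_starts_off; last exact: edge_starts_off.
  have -> : bd e (repg_e e h) = h by rewrite [RHS]hE (fcrs1 (fc (o e))) mulg1.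
  by rewrite -mE nE.
set p := rep_e e h in hE ir *.
(* Here the second edge letter meets [inr e] with an empty prefix in between, and the two cancel. *)
have -> : act_edge (rev e) (inr e :: block p ++ post (o e) n) = block p ++ post (o e) n.
  rewrite /act_edge; have [//|-> ->] := @split_starts_off (o (rev e)) (inr e :: block p ++ post (o e) n).
  rewrite (fcrs1 (fc (o (rev e)))); have [-> ->] := rep_e1 (rev e).
  rewrite rev_elt1 multiplicative1.
  have -> : @attach (rev e) [::] (inr e :: block p ++ post (o e) n) = block p ++ post (o e) n
      :> seq L by rewrite /attach rev_edgeK eqxx.
  apply: act1.
  apply: NormalVertex => //; first exact: post_starts_off.
  exact: edge_irr_irreducible ir.
by rewrite act_cat -?hE; last exact: post_starts_off.
Qed.

Lemma act_edgeVK e n : normal n -> act_edge e (act_edge (rev e) n) = n.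
Proof. by move=> nn; rewrite -{1}(rev_edgeK e) act_edgeK. Qed.

(** * Comparison with the presentation of F *)

Section Presentation.
Variable S : V -> Type.
Variable R : forall v, rules (S v * bool).
Variable pi : forall v, seq (S v * bool) -> vertex_group GG v.
Hypothesis vertex_pres : forall v, group_presentation (@R v) (@pi v).
Variables (F : groupType) (piF : seq (F_gen S * bool) -> F).
Hypothesis F_pres : group_presentation (F_rel R pi) piF.

Local Notation FL v := (@F_lift Gamma S v).

Lemma piM v (a b : seq (S v * bool)) : pi (a ++ b) = pi a * pi b.
Proof. by case: (vertex_pres v) => [[_ ->]]. Qed.

Lemma pi1 v : @pi v [::] = 1.
Proof. by case: (vertex_pres v) => [[]]. Qed.

Lemma pi_surj v g : exists w, @pi v w = g.
Proof.
case: (vertex_pres v) => _ h _; have : [set: vertex_group GG v] g by [].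
by rewrite -h => -[w _ <-]; exists w.
Qed.

Lemma piFM a b : piF (a ++ b) = piF a * piF b.
Proof. by case: F_pres => [[_ ->]]. Qed.

Lemma piF1 : piF [::] = 1.
Proof. by case: F_pres => [[]]. Qed.

Lemma piF_congr a b :
  piF a = piF b <-> congruence (F_rel R pi `|` @cancellation (F_gen S)) a b.
Proof. by case: F_pres. Qed.

Lemma piF_cons x a : piF (x :: a) = piF [:: x] * piF a.
Proof. by rewrite -piFM. Qed.

Lemma piF_cancel x b : piF [:: (x, b)] * piF [:: (x, ~~ b)] = 1.
Proof.
rewrite -piFM -piF1; apply/piF_congr/congruence_rule; right.
by exists x, b.
Qed.

Lemma F_lift_cat v (a b : seq (S v * bool)) : FL v (a ++ b) = FL v a ++ FL v b.
Proof. exact: map_cat. Qed.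

(** The relations of the vertex group are among those of F, so [F_lift] induces a homomorphism from
    the vertex group to F. *)
Lemma piF_lift v (a b : seq (S v * bool)) : pi a = pi b -> piF (FL v a) = piF (FL v b).
Proof.
case: (vertex_pres v) => _ _ h /h.
refine (@congruence_ind _ _ (fun a b => piF (FL v a) = piF (FL v b)) _ _ _ _ _ _) => //.
  by move=> x y z -> ->.
move=> _ _ [x1 [x2 [l [r [hr -> ->]]]]]; rewrite !F_lift_cat !piFM.
congr (_ * (_ * _)); apply/piF_congr/congruence_rule.
case: hr => [hr|[s [c [-> ->]]]]; first by left; exact: (F_vertex pi hr).
by right; exists (inl (existT S v s)), c.
Qed.

(** The letter t_e acts as the inverse of t_(rev e), which is why it uses [act_edge (rev e)]. *)
Definition act_letter (x : F_gen S * bool) (n : seq L) : seq L :=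
  match x with
  | (inl t, b) => act (pi [:: (tagged t, b)]) n
  | (inr e, true) => act_edge e n
  | (inr e, false) => act_edge (rev e) n
  end.

Definition act_word (z : seq (F_gen S * bool)) (n : seq L) := foldr act_letter n z.

Lemma act_word_cat a b n : act_word (a ++ b) n = act_word a (act_word b n).
Proof. exact: foldr_cat. Qed.

Lemma act_word_normal z n : normal n -> normal (act_word z n).
Proof.
move=> nn; elim: z => //= -[[t|e] [|]] z IH;
  [exact: act_normal|exact: act_normal|exact: act_edge_normal|exact: act_edge_normal].
Qed.

Lemma act_word_lift v (w : seq (S v * bool)) n : normal n ->
  act_word (FL v w) n = act (pi w) n.
Proof.
move=> nn; elim: w => [|[s b] w IH] /=; first by rewrite pi1 act1.
by rewrite -/(act_word _ _) IH actM -piM.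
Qed.

(** The conjugation relation is [act_edge_conj], and cancellation of edge letters is [act_edgeK].
    Normality is needed for 1 to act trivially. *)
Lemma act_word_rel l r n : (F_rel R pi `|` @cancellation (F_gen S)) (l, r) ->
  normal n -> act_word l n = act_word r n.
Proof.
move=> h nn; case: h => [h|[[[v s]|e] [b [-> ->]]]].
- suff rel lr : F_rel R pi lr -> act_word lr.1 n = act_word lr.2 n by exact: rel h.
  case=> [v [a b] hr|e|e g w w' hw hw'] /=.
  + rewrite !act_word_lift //; congr act.
    by case: (vertex_pres v) => _ _ ->; apply: congruence_rule; left.
  + by rewrite rev_edgeK.
  + rewrite -/(act_word _ _) act_word_cat act_word_lift /=; last exact: act_edge_normal.
    by rewrite hw act_edge_conj act_edgeVK // act_word_lift // hw'.
- rewrite /= actM -piM; have -> : pi ([:: (s, b)] ++ [:: (s, ~~ b)]) = 1.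
    rewrite -pi1; case: (vertex_pres v) => _ _ ->.
    by apply: congruence_rule; right; exists s, b.
  exact: act1.
- by case: b => /=; [exact: act_edgeVK|exact: act_edgeK].
Qed.

Lemma act_word_congr a b n : piF a = piF b -> normal n -> act_word a n = act_word b n.
Proof.
move=> /piF_congr h nn; move: a b h.
refine (@congruence_ind _ _ (fun a b => act_word a n = act_word b n) _ _ _ _) => //.
  by move=> x y z -> ->.
move=> _ _ [x1 [x2 [l [r [hr -> ->]]]]]; rewrite !act_word_cat.
by rewrite (act_word_rel hr) //; exact: act_word_normal.
Qed.

(** * The epimorphism onto F *)

(** The presentation and the rewriting system of a vertex group have unrelated alphabets; this
    translates between them. *)
Definition spell v (x : X v) : seq (S v * bool) := sval (cid (pi_surj (rho [:: x]))).

Lemma spellP v (x : X v) : pi (spell x) = rho [:: x].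
Proof. by rewrite /spell; case: cid. Qed.

Definition F_word1 (l : L) : seq (F_gen S * bool) :=
  match l with
  | inl t => FL (tag t) (spell (tagged t))
  | inr e => [:: (inr e, true)]
  end.
Definition F_word (u : seq L) := flatten (map F_word1 u).
Definition phi (u : seq L) : F := piF (F_word u).

Lemma phiM a b : phi (a ++ b) = phi a * phi b.
Proof. by rewrite /phi /F_word map_cat flatten_cat piFM. Qed.

Lemma phi1 : phi [::] = 1. Proof. exact: piF1. Qed.

Lemma phi_cons l u : phi (l :: u) = phi [:: l] * phi u.
Proof. by rewrite -phiM. Qed.

Lemma phi_edge e : phi [:: inr e] = piF [:: (inr e, true)]. Proof. by []. Qed.

Lemma phi_block v (p : seq (X v)) w : pi w = rho p -> phi (block p) = piF (FL v w).
Proof.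
move=> hw.
have -> : phi (block p) = piF (FL v (flatten (map (@spell v) p))).
  rewrite /phi; congr piF; rewrite /F_word; elim: p {hw} => //= x p ->.
  by rewrite F_lift_cat.
apply: piF_lift; rewrite hw; apply: word_morphism_flatten.
- by split; [exact: fcrs1 (fc v)|exact: fcrsM (fc v)].
- by split; [exact: pi1|exact: piM].
- exact: spellP.
Qed.

Lemma piF_inv e : piF [:: (inr e, true)] = piF [:: (inr (rev e), false)].
Proof. by apply/piF_congr/congruence_rule; left; exact: F_inv. Qed.

Lemma phi_conj e (g : edge_group GG e) p q :
  rho p = bd e g -> rho q = bd (rev e) (rev_elt g) ->
  phi (inr e :: block p) = phi (block q ++ [:: inr e]).
Proof.
move=> hp hq; have [w hw] := pi_surj (bd e g).
have [w' hw'] := pi_surj (bd (rev e) (rev_elt g)).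
rewrite phi_cons phiM phi_edge (phi_block (w := w)) ?hw // (phi_block (w := w')) ?hw' //.
(* By the relation for g, the right side is t_e^-1 w t_e t_e^-1, where the last two letters
   cancel. *)
have -> : piF (FL (o (rev e)) w') = piF ((inr e, true) :: FL (o e) w ++ [:: (inr e, false)]).
  by apply/esym/piF_congr/congruence_rule; left; exact: F_conj hw hw'.
rewrite [piF (_ :: _ ++ _)]piF_cons piFM -!mulgA; congr (_ * _).
by rewrite (piF_cancel (inr e) false) mulg1.
Qed.

Lemma phi_F_rules l r : F_rules (l, r) -> phi l = phi r.
Proof.
case/F_rulesP => [i u v h|e u v w _ huv|e].
- have [a ha] := pi_surj (rho u); have [b hb] := pi_surj (rho v).
  rewrite (phi_block ha) (phi_block hb); apply: piF_lift; rewrite ha hb.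
  exact/(fcrs_congr (fc i))/congruence_rule.
- have [g [hv hcv]] := carryP v.
  have [a ha] := fcrs_surj (fc (o e)) (piY v).
  (* In the vertex group u is [a] times w with [a] in the edge subgroup, so only [a] has to cross
     the edge letter. *)
  have -> : phi (inr e :: block u) = phi ((inr e :: block a) ++ block w).
    rewrite cat_cons -block_cat !(phi_cons _ (block _)); congr (_ * _).
    have [b hb] := pi_surj (rho u).
    by rewrite !(phi_block (w := b)) // (fcrsM (fc (o e))) ha -huv hb.
  by rewrite (phiM (inr e :: block a)) (phi_conj (etrans ha hv) hcv) -phiM -catA.
- by rewrite phi_cons !phi_edge piF_inv rev_edgeK (piF_cancel (inr e) false) phi1.
Qed.

Lemma phi_congr a b : congruence F_rules a b -> phi a = phi b.
Proof.
move: a b; refine (@congruence_ind _ _ (fun a b => phi a = phi b) _ _ _ _) => //.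
  by move=> x y z -> ->.
move=> _ _ [x1 [x2 [l [r [hr -> ->]]]]]; by rewrite !phiM (phi_F_rules hr).
Qed.

(** * Rewriting to normal words and confluence *)

Definition nf (u : seq L) : seq L := act_word (F_word u) [::].

Lemma rewrites_catl z x y : rewrites F_rules x y -> rewrites F_rules (z ++ x) (z ++ y).
Proof. by apply: rewrites_map => a b; exact: rewrite1_catl. Qed.

Lemma rewrites_catr z x y : rewrites F_rules x y -> rewrites F_rules (x ++ z) (y ++ z).
Proof. by apply: (rewrites_map (f := fun w => w ++ z)) => a b; exact: rewrite1_catr. Qed.

Lemma rewrites_act v (p : seq (X v)) n : rewrites F_rules (block p ++ n) (act (rho p) n).
Proof.
rewrite {1}(splitE v n) catA -block_cat /act; apply: rewrites_catr.
rewrite -(fcrsM (fc v)).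
apply: (rewrites_map (R := @Q v) (f := block)) (rewrites_fcrs_nf _ _) => a b.
exact: rewrite1_vertex.
Qed.

(** The reduction of the prefix behind [t] in the extended system, transferred, exposes
    representative and carried factor; a vertex action and at most one cancellation remain. *)
Lemma rewrites_act_edge e n : rewrites F_rules (inr e :: n) (act_edge e n).
Proof.
have [v [w [iw hp hr]]] := edge_reduce (fc (o e)) (@piY_mor e) (@RY_term e)
  (@RY_form e) (pre (o e) n).
have [g [hv hcv]] := carryP v.
(* The word [w] reached by rewriting is irreducible, hence it is the chosen representative. *)
have [rE gE] : rep_e e (rho (pre (o e) n)) = w /\ repg_e e (rho (pre (o e) n)) = g.
  rewrite hp hv; have [-> ->] := rep_eM g (rho w).
  by have [-> ->] := rep_e_rho iw; rewrite mulg1.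
rewrite /act_edge rE gE -hcv.
have st : rewrites F_rules (inr e :: n) (block (carry v) ++ inr e :: block w ++ post (o e) n).
  rewrite {1}(splitE (o e) n) -cat_cons; rewrite -[inr e :: block w ++ _]cat_cons catA.
  apply: rewrites_catr; have := rewrites_map (@rewrite1_transfer e) hr.
  by rewrite transfer_cat !transfer_t !transfer_l transfer_r.
apply: rewrites_trans st _; apply: rewrites_trans (rewrites_act _ _).
apply: rewrites_catl; case: attachP => [m' -> ->|_]; last exact: rt_refl.
apply: rt_step; rewrite -[m' in X in rewrite1 _ _ X]cat0s.
rewrite -[_ :: _]/([:: inr e; inr (rev e)] ++ m'); apply: rewrite1_catr.
by apply: rewrite1_rule; right; exists (rev e) => //; rewrite /= rev_edgeK.
Qed.

Lemma nf_normal u : normal (nf u).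
Proof. exact/act_word_normal/NormalNil. Qed.

(** The letters act from right to left, each on a word that is already normal. *)
Lemma rewrites_nf u : rewrites F_rules u (nf u).
Proof.
elim: u => [|l u IH]; first exact: rt_refl.
apply: rewrites_trans (rewrites_catl [:: l] IH) _.
rewrite /nf /F_word /= act_word_cat -/(F_word u) -/(nf u).
case: l => [[v x]|e] /=; last exact: rewrites_act_edge.
rewrite act_word_lift ?spellP; last exact: nf_normal.
exact: (rewrites_act [:: x]).
Qed.

Lemma nf_phi a b : phi a = phi b -> nf a = nf b.
Proof. by move=> h; exact: act_word_congr h NormalNil. Qed.

Lemma nf_rewrites a b : rewrites F_rules a b -> nf a = nf b.
Proof. by move=> /rewrites_congruence/phi_congr/nf_phi. Qed.

(** [nf] depends only on the image in F and is constant along rewriting, so [nf x] is a common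
    reduct. *)
Lemma F_rules_confl : confluent F_rules.
Proof.
move=> x y z /nf_rewrites xy /nf_rewrites xz; exists (nf x).
by split; [rewrite xy|rewrite xz]; exact: rewrites_nf.
Qed.

Lemma phi_surj f : exists u, phi u = f.
Proof.
have : [set: F] f by [].
case: F_pres => _ <- _ [z _ <-]; elim: z => [|[[[v s]|e] b] z [u hu]].
- by exists [::]; rewrite phi1 piF1.
- have [p hp] := fcrs_surj (fc v) (pi [:: (s, b)]).
  by exists (block p ++ u); rewrite phiM hu piF_cons (phi_block (esym hp)).
(* Edge letters stand for inverses, so t_e is the image of [inr (rev e)]. *)
- exists (inr (if b then e else rev e) :: u); rewrite phi_cons hu piF_cons phi_edge.
  by case: b => //; rewrite piF_inv rev_edgeK.
Qed.

Lemma fundamental_group_fcrs : admits_fcrs F.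
Proof.
exists ({v & X v} + edge Gamma)%type, F_rules, phi.
split; [exact: F_rules_fin|by split; [exact: F_rules_term|exact: F_rules_confl]|split].
- by split; [exact: phi1|exact: phiM].
- by apply/seteqP; split=> // f _; have [u <-] := phi_surj f; exists u.
- move=> a b; split; last exact: phi_congr.
  move=> /nf_phi ab; apply: (rst_trans _ _ _ (nf a)).
    exact/rewrites_congruence/rewrites_nf.
  by rewrite ab; apply/rst_sym/rewrites_congruence/rewrites_nf.
Qed.

End Presentation.
End GraphOfRewritingSystems.

(** * Choice of the vertex and edge data *)

(** The cast runs along a loop at [orig e], which is trivial by proof irrelevance. *)
Lemma incident_subgroup_orig (Gamma : finite_graph) (GG : graph_of_groups Gamma)
    (e : edge Gamma) :
  incident_subgroup (GG := GG) (exist _ e erefl : incident_edge (orig e))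
  = range (boundary GG e).
Proof.
have cast_id (E : orig e = orig e) :
    ecast w (set (vertex_group GG w)) E (range (boundary GG e)) = range (boundary GG e).
  by rewrite (Prop_irrelevance E erefl).
exact: cast_id.
Qed.

Theorem theorem2p9
  (Gamma : finite_graph) (Gamma_conn : connected_graph Gamma)
  (GG : graph_of_groups Gamma)
  (vertex_fcrs : forall v : vertex Gamma,
    exists (X : finType) (Q : rules X) (rho : seq X -> vertex_group GG v),
      is_fcrs Q rho /\ left_compatible Q rho (@incident_subgroup Gamma GG v))
  (S : vertex Gamma -> Type)
  (R : forall v, rules (S v * bool))
  (pi : forall v, seq (S v * bool) -> vertex_group GG v)
  (vertex_pres : forall v, group_presentation (R v) (pi v))
  (F : groupType) (piF : seq (F_gen S * bool) -> F)
  (F_pres : group_presentation (F_rel R pi) piF) :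
  admits_fcrs F.
Proof.
have [X [Q [rho [fc lc]]]] : exists (X : vertex Gamma -> finType)
    (Q : forall v, rules (X v)) (rho : forall v, seq (X v) -> vertex_group GG v),
    (forall v, is_fcrs (Q v) (rho v)) /\
    (forall v, left_compatible (Q v) (rho v) (@incident_subgroup Gamma GG v)).
  (* Vertices form a finite type, so systems for all of them are picked at once by finite choice. *)
  have [X hX] := fin_all_exists vertex_fcrs; have [Q hQ] := fin_all_exists hX.
  have [rho h] := fin_all_exists hQ.
  by exists X, Q, rho; split=> v; have [] := h v.
have {}lc e : left_compatible_with (Q (orig e)) (rho (orig e)) (range (boundary GG e)).
  by rewrite -incident_subgroup_orig; exact: lc.
have [Y hY] := fin_all_exists lc; have [piY hpi] := fin_all_exists hY.
have [RY hRY] := fin_all_exists hpi.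
refine (@fundamental_group_fcrs Gamma GG X Q rho fc Y piY RY _ _ _ _ _ _
  S R pi vertex_pres F piF F_pres) => e.
- by case: (hRY e) => -[].
- by case: (hRY e) => -[].
- by case: (hRY e).
- by case: (hRY e).
- by case: (hRY e).
- by case: (hRY e).
Qed.
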